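(* For all GKAT expressions $e, f \in \mathrm{Exp}$, \[ [\![e]\!] = [\![f]\!] \quad\Longleftrightarrow\quad \text{for every probabilistic interpretation } i,\ \mathcal{P}_i[\![e]\!] = \mathcal{P}_i[\![f]\!]. \] That is, the language model is sound and complete for the probabilistic model.
   Context: Syntax. Fix disjoint nonempty sets $\Sigma$ (actions) and $T=\{t_1,\dots,t_n\}$ (primitive tests), $T$ finite. Boolean expressions $b,c\in\mathrm{BExp}$ are generated by $0 \mid 1 \mid t\in T \mid b\cdot c \mid b+c \mid \overline{b}$. GKAT expressions $e,f\in\mathrm{Exp}$ are generated by $p\in\Sigma \mid b\in\mathrm{BExp} \mid e\cdot f \mid e+_b f \mid e^{(b)}$. $\equiv_{BA}$ denotes Boolean equivalence, $b\le c$ iff $b+c\equiv_{BA}c$. $\mathrm{At}$ is the finite set of atoms (minimal nonzero elements) of the free Boolean algebra $\mathrm{BExp}/{\equiv_{BA}}$ on $T$, i.e. truth assignments on $T$. Language model. Guarded strings: $\mathrm{GS}=\mathrm{At}\cdot(\Sigma\cdot\mathrm{At})^*$. Fusion product: $x\alpha\diamond\beta y = x\alpha y$ if $\alpha=\beta$, undefined otherwise; for $L,K\subseteq\mathrm{GS}$, $L\diamond K=\{x\diamond y : x\in L,y\in K, x\diamond y\text{ defined}\}$; $L^0=\mathrm{At}$, $L^{n+1}=L^n\diamond L$. For $B\subseteq\mathrm{At}$, $\overline{B}=\mathrm{At}\setminus B$, $L+_BK=(B\diamond L)\cup(\overline{B}\diamond K)$, $L^{(B)}=\bigcup_{n\ge0}(B\diamond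 L)^n\diamond\overline{B}$. Then $[\![-]\!]:\mathrm{Exp}\to 2^{\mathrm{GS}}$ is: $[\![p]\!]=\{\alpha p\beta:\alpha,\beta\in\mathrm{At}\}$, $[\![b]\!]=\{\alpha\in\mathrm{At}:\alpha\le b\}$, $[\![e\cdot f]\!]=[\![e]\!]\diamond[\![f]\!]$, $[\![e+_bf]\!]=[\![e]\!]+_{[\![b]\!]}[\![f]\!]$, $[\![e^{(b)}]\!]=[\![e]\!]^{([\![b]\!])}$. Probabilistic model. For a countable set $X$, $\mathcal{D}(X)$ is the set of subdistributions on $X$, i.e. $f:X\to[0,1]$ with $\sum_{x}f(x)\le1$; $\delta_x$ is the point mass at $x$; $[\phi]$ is $1$ if $\phi$ holds and $0$ otherwise. A probabilistic interpretation is a triple $i=(\mathrm{State},\mathrm{eval},\mathrm{sat})$ consisting of a countable set $\mathrm{State}$, a sub-Markov kernel $\mathrm{eval}(p):\mathrm{State}\to\mathcal{D}(\mathrm{State})$ for each $p\in\Sigma$, and a set $\mathrm{sat}(t)\subseteq\mathrm{State}$ for each $t\in T$; $\mathrm{sat}^\dagger:\mathrm{BExp}\to2^{\mathrm{State}}$ is the usual Boolean lifting of $\mathrm{sat}$. The kernel $\mathcal{P}_i[\![e]\!]:\mathrm{State}\to\mathcal{D}(\mathrm{State})$ is defined by - $\mathcal{P}_i[\![p]\!]=\mathrm{eval}(p)$; $\mathcal{P}_i[\![b]\!](\sigma)=[\sigma\in\mathrm{sat}^\dagger(b)]\cdot\delta_\sigma$; - $\mathcal{P}_i[\![e\cdot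 f]\!](\sigma)(\sigma')=\sum_{\sigma''}\mathcal{P}_i[\![e]\!](\sigma)(\sigma'')\cdot\mathcal{P}_i[\![f]\!](\sigma'')(\sigma')$; - $\mathcal{P}_i[\![e+_bf]\!](\sigma)=[\sigma\in\mathrm{sat}^\dagger(b)]\cdot\mathcal{P}_i[\![e]\!](\sigma)+[\sigma\in\mathrm{sat}^\dagger(\overline{b})]\cdot\mathcal{P}_i[\![f]\!](\sigma)$; - $\mathcal{P}_i[\![e^{(b)}]\!](\sigma)(\sigma')=\lim_{n\to\infty}\mathcal{P}_i[\![(e+_b1)^n\cdot\overline{b}]\!](\sigma)(\sigma')$, where $g^n$ is the $n$-fold sequential composition of $g$ with $g^0=1$. (The limit exists and each $\mathcal{P}_i[\![e]\!]$ is a sub-Markov kernel.) *)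

(* Defs.v *)
From HB Require Import structures.
From mathcomp Require Import all_boot all_order all_algebra.
From mathcomp Require Import all_classical all_reals all_analysis.

Set Implicit Arguments.
Unset Strict Implicit.
Unset Printing Implicit Defensive.
Import Order.TTheory GRing.Theory Num.Theory.
Import numFieldNormedType.Exports.
Local Open Scope classical_set_scope.
Local Open Scope ring_scope.

Inductive bexp (T : Type) : Type :=
| BZero
| BOne
| BTest of T
| BAnd of bexp T & bexp T
| BOr of bexp T & bexp T
| BNot of bexp T.

Arguments BZero {T}.
Arguments BOne {T}.

Inductive exp (Sigma T : Type) : Type :=
| Act of Sigma
| Bool of bexp T
| Seq of exp Sigma T & exp Sigma T
| Ite of bexp T & exp Sigma T & exp Sigma T
| Loop of bexp T & exp Sigma T.

Arguments Bool {Sigma T}.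
Arguments Act {Sigma T}.

Fixpoint epow (Sigma T : Type) (g : exp Sigma T) (n : nat) : exp Sigma T :=
  if n is m.+1 then Seq (epow g m) g else Bool BOne.

Section BooleanEquivalence.
Context {T : Type}.

(* The least congruence containing the axioms of Boolean algebra. *)
Inductive ba_equiv : bexp T -> bexp T -> Prop :=
| ba_refl b : ba_equiv b b
| ba_sym b c : ba_equiv b c -> ba_equiv c b
| ba_trans b c d : ba_equiv b c -> ba_equiv c d -> ba_equiv b d
| ba_congAnd b b' c c' :
    ba_equiv b b' -> ba_equiv c c' -> ba_equiv (BAnd b c) (BAnd b' c')
| ba_congOr b b' c c' :
    ba_equiv b b' -> ba_equiv c c' -> ba_equiv (BOr b c) (BOr b' c')
| ba_congNot b b' : ba_equiv b b' -> ba_equiv (BNot b) (BNot b')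
| ba_andA b c d : ba_equiv (BAnd b (BAnd c d)) (BAnd (BAnd b c) d)
| ba_orA b c d : ba_equiv (BOr b (BOr c d)) (BOr (BOr b c) d)
| ba_andC b c : ba_equiv (BAnd b c) (BAnd c b)
| ba_orC b c : ba_equiv (BOr b c) (BOr c b)
| ba_and1 b : ba_equiv (BAnd b BOne) b
| ba_or0 b : ba_equiv (BOr b BZero) b
| ba_andDr b c d : ba_equiv (BAnd b (BOr c d)) (BOr (BAnd b c) (BAnd b d))
| ba_orDr b c d : ba_equiv (BOr b (BAnd c d)) (BAnd (BOr b c) (BOr b d))
| ba_andN b : ba_equiv (BAnd b (BNot b)) BZero
| ba_orN b : ba_equiv (BOr b (BNot b)) BOne.

Definition ba_le (b c : bexp T) : Prop := ba_equiv (BOr b c) c.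

Fixpoint beval (v : T -> bool) (b : bexp T) : bool :=
  match b with
  | BZero => false
  | BOne => true
  | BTest t => v t
  | BAnd b c => beval v b && beval v c
  | BOr b c => beval v b || beval v c
  | BNot b => ~~ beval v b
  end.

End BooleanEquivalence.

(* Truth assignments; [atom_expr] turns one into the Boolean expression
   (a product of literals) whose class is the corresponding atom. *)
Definition atom (T : finType) := {ffun T -> bool}.

Definition literal (T : finType) (a : atom T) (t : T) : bexp T :=
  if a t then BTest t else BNot (BTest t).

Definition atom_expr (T : finType) (a : atom T) : bexp T :=
  foldr (fun t b => BAnd (literal a t) b) BOne (enum T).

Section AtomLe.
Context {T : finType}.
Implicit Types (a : atom T) (b c : bexp T).

Lemma ba_equiv_beval (v : T -> bool) b c :
  ba_equiv b c -> beval v b = beval v c.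
Proof.
elim=> //= {b c}.
- by move=> b c d _ -> _ ->.
- by move=> b b' c c' _ -> _ ->.
- by move=> b b' c c' _ -> _ ->.
- by move=> b b' _ ->.
- by move=> b c d; rewrite andbA.
- by move=> b c d; rewrite orbA.
- by move=> b c; rewrite andbC.
- by move=> b c; rewrite orbC.
- by move=> b; rewrite andbT.
- by move=> b; rewrite orbF.
- by move=> b c d; rewrite andb_orr.
- by move=> b c d; rewrite orb_andr.
- by move=> b; rewrite andbN.
- by move=> b; rewrite orbN.
Qed.

Lemma beval_atom_expr a a' : beval a' (atom_expr a) = (a' == a).
Proof.
have -> : beval a' (atom_expr a) = all (fun t => a' t == a t) (enum T).
  rewrite /atom_expr; elim: (enum T) => //= t s ->; congr andb.
  by rewrite /literal; case: (a t); rewrite /= ?eqb_id ?eqbF_neg.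
apply/allP/eqP => [h|-> //]; apply/ffunP => t.
by apply/eqP/h; rewrite mem_enum.
Qed.

Local Notation "b =B c" := (ba_equiv b c) (at level 70).

Let ba_and0 b : BAnd b BZero =B BZero.
Proof.
apply: ba_trans (ba_sym (ba_or0 _)) _.
apply: ba_trans (ba_congOr (ba_refl _) (ba_sym (ba_andN b))) _.
apply: ba_trans (ba_sym (ba_andDr _ _ _)) _.
apply: ba_trans (ba_congAnd (ba_refl _) (ba_orC _ _)) _.
apply: ba_trans (ba_congAnd (ba_refl _) (ba_or0 _)) _.
exact: ba_andN.
Qed.

Let ba_andK b : BAnd b b =B b.
Proof.
apply: ba_trans (ba_sym (ba_or0 _)) _.
apply: ba_trans (ba_congOr (ba_refl _) (ba_sym (ba_andN b))) _.
apply: ba_trans (ba_sym (ba_andDr _ _ _)) _.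
apply: ba_trans (ba_congAnd (ba_refl _) (ba_orN _)) _.
exact: ba_and1.
Qed.

Let ba_or1 b : BOr b BOne =B BOne.
Proof.
apply: ba_trans (ba_sym (ba_and1 _)) _.
apply: ba_trans (ba_congAnd (ba_refl _) (ba_sym (ba_orN b))) _.
apply: ba_trans (ba_sym (ba_orDr _ _ _)) _.
apply: ba_trans (ba_congOr (ba_refl _) (ba_andC _ _)) _.
apply: ba_trans (ba_congOr (ba_refl _) (ba_and1 _)) _.
exact: ba_orN.
Qed.

Let ba_orK b : BOr b b =B b.
Proof.
apply: ba_trans (ba_sym (ba_and1 _)) _.
apply: ba_trans (ba_congAnd (ba_refl _) (ba_sym (ba_orN b))) _.
apply: ba_trans (ba_sym (ba_orDr _ _ _)) _.
apply: ba_trans (ba_congOr (ba_refl _) (ba_andN _)) _.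
exact: ba_or0.
Qed.

Let and_neg0 x b : BAnd x b =B x -> BAnd x (BNot b) =B BZero.
Proof.
move=> h; apply: ba_trans (ba_congAnd (ba_sym h) (ba_refl _)) _.
apply: ba_trans (ba_sym (ba_andA _ _ _)) _.
apply: ba_trans (ba_congAnd (ba_refl _) (ba_andN _)) _.
exact: ba_and0.
Qed.

Let and_negx x b : BAnd x b =B BZero -> BAnd x (BNot b) =B x.
Proof.
move=> h; apply: ba_trans (ba_sym (ba_or0 _)) _.
apply: ba_trans (ba_congOr (ba_refl _) (ba_sym h)) _.
apply: ba_trans (ba_sym (ba_andDr _ _ _)) _.
apply: ba_trans (ba_congAnd (ba_refl _) (ba_orC _ _)) _.
apply: ba_trans (ba_congAnd (ba_refl _) (ba_orN _)) _.
exact: ba_and1.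
Qed.

Let atom_literal a t : BAnd (atom_expr a) (literal a t) =B atom_expr a.
Proof.
have : t \in enum T by rewrite mem_enum.
rewrite /atom_expr; elim: (enum T) => //= u s IH.
rewrite in_cons => /orP[/eqP<-|/IH {}IH].
  apply: ba_trans (ba_andC _ _) _; apply: ba_trans (ba_andA _ _ _) _.
  exact: ba_congAnd (ba_andK _) (ba_refl _).
apply: ba_trans (ba_sym (ba_andA _ _ _)) _.
exact: ba_congAnd (ba_refl _) IH.
Qed.

Let atom_decides a b :
  BAnd (atom_expr a) b =B (if beval a b then atom_expr a else BZero).
Proof.
elim: b => [||t|b IHb c IHc|b IHb c IHc|b IHb] /=.
- exact: ba_and0.
- exact: ba_and1.
- have := atom_literal a t; rewrite /literal; case: (a t) => // h.
  apply: ba_trans (ba_congAnd (ba_sym h) (ba_refl _)) _.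
  apply: ba_trans (ba_sym (ba_andA _ _ _)) _.
  apply: ba_trans (ba_congAnd (ba_refl _) (ba_andC _ _)) _.
  apply: ba_trans (ba_congAnd (ba_refl _) (ba_andN _)) _.
  exact: ba_and0.
- apply: ba_trans (ba_andA _ _ _) _.
  apply: ba_trans (ba_congAnd IHb (ba_refl _)) _; case: (beval a b) => //=.
  by apply: ba_trans (ba_andC _ _) _; exact: ba_and0.
- apply: ba_trans (ba_andDr _ _ _) _.
  apply: ba_trans (ba_congOr IHb IHc) _.
  case: (beval a b); case: (beval a c) => /=; do ?[exact: ba_orK].
    exact: ba_or0.
  by apply: ba_trans (ba_orC _ _) _; exact: ba_or0.
- by case: (beval a b) IHb => /= h; [exact: and_neg0 | exact: and_negx].
Qed.

Lemma atom_leE a b : ba_le (atom_expr a) b <-> beval a b.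
Proof.
split=> [/(ba_equiv_beval a) /= <-|ab]; first by rewrite beval_atom_expr eqxx.
have := atom_decides a b; rewrite ab => h; rewrite /ba_le.
apply: ba_trans (ba_congOr (ba_sym h) (ba_refl _)) _.
apply: ba_trans (ba_orC _ _) _; apply: ba_trans (ba_orDr _ _ _) _.
apply: ba_trans (ba_congAnd (ba_refl _) (ba_orK _)) _.
apply: ba_trans (ba_andC _ _) _.
apply: ba_trans (ba_congAnd (ba_sym (ba_or0 _)) (ba_refl _)) _.
apply: ba_trans (ba_sym (ba_orDr _ _ _)) _.
apply: ba_trans (ba_congOr (ba_refl _) (ba_andC _ _)) _.
by apply: ba_trans (ba_congOr (ba_refl _) (ba_and0 _)) _; exact: ba_or0.
Qed.

End AtomLe.

Section LanguageModel.
Context {Sigma : Type} {T : finType}.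

(* [(a0, [:: (p1, a1); ...; (pn, an)])] is the guarded string
   a0 p1 a1 ... pn an. *)
Definition gstring : Type := (atom T * seq (Sigma * atom T))%type.

Definition gs_last (x : gstring) : atom T := last x.1 (map snd x.2).

Definition fuse (x y : gstring) : option gstring :=
  if gs_last x == y.1 then Some (x.1, x.2 ++ y.2) else None.

Definition lang_atoms (B : set (atom T)) : set gstring :=
  [set (a, [::]) | a in B].

Definition lang_fuse (L K : set gstring) : set gstring :=
  [set z | exists x y, [/\ L x, K y & fuse x y = Some z]].

Fixpoint lang_pow (L : set gstring) (n : nat) : set gstring :=
  if n is m.+1 then lang_fuse (lang_pow L m) L else lang_atoms setT.

Definition lang_ite (B : set (atom T)) (L K : set gstring) : set gstring :=
  lang_fuse (lang_atoms B) L `|` lang_fuse (lang_atoms (~` B)) K.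

Definition lang_loop (B : set (atom T)) (L : set gstring) : set gstring :=
  \bigcup_(n in [set: nat])
    lang_fuse (lang_pow (lang_fuse (lang_atoms B) L) n) (lang_atoms (~` B)).

Definition bsem (b : bexp T) : set (atom T) :=
  [set a | ba_le (atom_expr a) b].

Fixpoint lang (e : exp Sigma T) : set gstring :=
  match e with
  | Act p => [set x | exists a b, x = (a, [:: (p, b)])]
  | Bool b => lang_atoms (bsem b)
  | Seq e f => lang_fuse (lang e) (lang f)
  | Ite b e f => lang_ite (bsem b) (lang e) (lang f)
  | Loop b e => lang_loop (bsem b) (lang e)
  end.

End LanguageModel.

(* The bound [f x <= 1] is [subdist_le1] below. *)
Record subdist (R : realType) (X : countType) := Subdist {
  subdist_fun :> X -> R;
  subdist_ge0 : forall x, 0 <= subdist_fun x;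
  subdist_sum_le1 : (\esum_(x in [set: X]) (subdist_fun x)%:E <= 1)%E
}.

Definition kernel (R : realType) (X : countType) := X -> subdist R X.

Section Subdistributions.
Context {R : realType} {X : countType}.
Implicit Types (f : X -> R) (k l : kernel R X) (B : set X).

Lemma eq_subdist (d d' : subdist R X) : d =1 d' -> d = d'.
Proof.
case: d d' => [f f0 f1] [g g0 g1] /= /funext fg.
by case: _ / fg in g0 g1 *; congr Subdist; exact: Prop_irrelevance.
Qed.

Lemma eq_kernel k l : (forall x y, k x y = l x y) -> k = l.
Proof. by move=> kl; apply/funext => x; apply: eq_subdist => y. Qed.

Lemma esum_le1P f : (forall x, 0 <= f x) ->
  (\esum_(x in [set: X]) (f x)%:E <= 1)%E <->
  (forall r : seq X, uniq r -> \sum_(x <- r) f x <= 1).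
Proof.
move=> f0; split=> [f1 r ur|h].
  rewrite -lee_fin; apply: le_trans f1; apply: ereal_sup_ubound.
  exists [set` r]; first by split=> //; exact: finite_seq.
  by rewrite -fsbig_seq// sumEFin.
apply: ge_ereal_sup => _ [A [finA _] <-].
by rewrite fsbig_finite//= sumEFin lee_fin; apply: h; exact: finmap.fset_uniq.
Qed.

Lemma subdist_fin_le1 (d : subdist R X) (r : seq X) :
  uniq r -> \sum_(x <- r) d x <= 1.
Proof.
by move: r; apply/esum_le1P; [exact: subdist_ge0|exact: subdist_sum_le1].
Qed.

Lemma subdist_le1 (d : subdist R X) x : d x <= 1.
Proof. by have := @subdist_fin_le1 d [:: x] isT; rewrite big_seq1. Qed.

Definition test_fun B (x y : X) : R := (x \in B)%:R * (x == y)%:R.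

Lemma test_ge0 B x y : 0 <= test_fun B x y.
Proof. by rewrite mulr_ge0. Qed.

Lemma test_sum_le1 B x : (\esum_(y in [set: X]) (test_fun B x y)%:E <= 1)%E.
Proof.
apply/esum_le1P => [y|r ur]; first exact: test_ge0.
rewrite -mulr_sumr mulr_ile1 ?sumr_ge0// ?lern1 ?leq_b1//.
rewrite -natr_sum lern1 -big_mkcond sum1_count.
rewrite (eq_count (a2 := pred1 x)); last by move=> y /=; rewrite eq_sym.
by rewrite count_uniq_mem// leq_b1.
Qed.

Definition ktest B : kernel R X :=
  fun x => Subdist (test_ge0 B x) (test_sum_le1 B x).

Definition seq_fun k l (x z : X) : R :=
  fine (\esum_(y in [set: X]) (k x y * l y z)%:E).

Lemma seq_esum_ge0 k l x z : (0 <= \esum_(y in [set: X]) (k x y * l y z)%:E)%E.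
Proof.
by apply: esum_ge0 => y _; rewrite lee_fin mulr_ge0 ?subdist_ge0.
Qed.

Lemma seq_funE k l x z :
  (seq_fun k l x z)%:E = (\esum_(y in [set: X]) (k x y * l y z)%:E)%E.
Proof.
rewrite fineK// ge0_fin_numE ?seq_esum_ge0//.
apply: (@le_lt_trans _ _ 1%E); last exact: ltry.
apply: le_trans (subdist_sum_le1 (k x)); apply: le_esum => y _.
by rewrite lee_fin ler_piMr ?subdist_ge0 ?subdist_le1.
Qed.

Lemma seq_ge0 k l x z : 0 <= seq_fun k l x z.
Proof. by rewrite fine_ge0 ?seq_esum_ge0. Qed.

Lemma seq_sum_le1 k l x :
  (\esum_(z in [set: X]) (seq_fun k l x z)%:E <= 1)%E.
Proof.
apply/esum_le1P => [z|r ur]; first exact: seq_ge0.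
rewrite -lee_fin -sumEFin (eq_bigr _ (fun z _ => seq_funE k l x z)).
rewrite -esum_sum => [|y z _ _]; last first.
  by rewrite lee_fin mulr_ge0 ?subdist_ge0.
apply: le_trans (subdist_sum_le1 (k x)); apply: le_esum => y _.
rewrite sumEFin lee_fin -mulr_sumr ler_piMr ?subdist_ge0//.
exact: subdist_fin_le1.
Qed.

Definition kseq k l : kernel R X :=
  fun x => Subdist (seq_ge0 k l x) (seq_sum_le1 k l x).

Definition ite_fun B k l (x y : X) : R :=
  (x \in B)%:R * k x y + (x \in ~` B)%:R * l x y.

Lemma ite_funE B k l x : ite_fun B k l x =1 if x \in B then k x else l x.
Proof.
by move=> y; rewrite /ite_fun in_setC; case: (x \in B);
  rewrite /= mul1r mul0r ?addr0 ?add0r.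
Qed.

Lemma ite_ge0 B k l x y : 0 <= ite_fun B k l x y.
Proof. by rewrite ite_funE subdist_ge0. Qed.

Lemma ite_sum_le1 B k l x :
  (\esum_(y in [set: X]) (ite_fun B k l x y)%:E <= 1)%E.
Proof.
rewrite (eq_esum (b := fun y => ((if x \in B then k x else l x) y)%:E)).
  exact: subdist_sum_le1.
by move=> y _; rewrite ite_funE.
Qed.

Definition kite B k l : kernel R X :=
  fun x => Subdist (ite_ge0 B k l x) (ite_sum_le1 B k l x).

Fixpoint kpow k (n : nat) : kernel R X :=
  if n is m.+1 then kseq (kpow k m) k else ktest setT.

Definition kunroll B k (n : nat) : kernel R X :=
  kseq (kpow (kite B k (ktest setT)) n) (ktest (~` B)).

Definition loop_fun B k (x y : X) : R := limn (fun n => kunroll B k n x y).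

Lemma kseq_testE k B x z : kseq k (ktest B) x z = k x z * (z \in B)%:R.
Proof.
apply: EFin_inj; rewrite [LHS]seq_funE (esumID [set z]); last first.
  by move=> y _; rewrite lee_fin mulr_ge0 ?subdist_ge0.
rewrite !setTI esum_set1 ?lee_fin ?mulr_ge0 ?subdist_ge0//.
rewrite esum1 ?adde0 /= /test_fun ?eqxx ?mulr1// => y /= /eqP /negbTE ->.
by rewrite !mulr0.
Qed.

Lemma kunroll_nondecreasing B k x y :
  nondecreasing_seq (fun n => kunroll B k n x y).
Proof.
set g := kite B k (ktest setT).
suff le_pow n : y \notin B -> kpow g n x y <= kpow g n.+1 x y.
  apply/nondecreasing_seqP => n.
  rewrite [leLHS](kseq_testE (kpow g n)) [leRHS](kseq_testE (kpow g n.+1)).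
  rewrite in_setC; case: (boolP (y \in B)) => yB; first by rewrite !mulr0.
  by rewrite !mulr1; exact: le_pow.
move=> yB; have -> : kpow g n.+1 = kseq (kpow g n) g by [].
have gyy : g y y = 1.
  by rewrite /g/= ite_funE (negbTE yB) /= /test_fun in_setT eqxx mulr1.
move: (kpow g n) => h; rewrite -lee_fin [leRHS]seq_funE.
apply: esum_ge; exists [set y]; first by split.
by rewrite fsbig_set1 lee_fin gyy mulr1.
Qed.

Lemma kunroll_cvg B k x y : cvgn (fun n => kunroll B k n x y).
Proof.
apply: nondecreasing_is_cvgn; first exact: kunroll_nondecreasing.
by exists 1 => _ [n _ <-]; exact: subdist_le1.
Qed.

Lemma loop_ge0 B k x y : 0 <= loop_fun B k x y.
Proof.
apply: limr_ge; first exact: kunroll_cvg.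
by apply: nearW => n; exact: subdist_ge0.
Qed.

Lemma loop_sum_le1 B k x :
  (\esum_(y in [set: X]) (loop_fun B k x y)%:E <= 1)%E.
Proof.
apply/esum_le1P => [y|r ur]; first exact: loop_ge0.
have h : (\sum_(y <- r) kunroll B k n x y) @[n --> \oo] -->
    \sum_(y <- r) loop_fun B k x y.
  by apply: cvg_big => [|y _]; [exact: add_continuous|exact: kunroll_cvg].
rewrite -(cvg_lim _ h)//; apply: limr_le; first by apply/cvg_ex; eexists; exact: h.
by apply: nearW => n; exact: subdist_fin_le1.
Qed.

Definition kloop B k : kernel R X :=
  fun x => Subdist (loop_ge0 B k x) (loop_sum_le1 B k x).

End Subdistributions.

Record interp (R : realType) (Sigma T : Type) := Interp {
  state : countType;
  eval : Sigma -> kernel R state;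
  sat : T -> set state
}.

Arguments eval {R Sigma T} i p : rename.
Arguments sat {R Sigma T} i t : rename.

Section ProbabilisticModel.
Context {R : realType} {Sigma T : Type} (i : interp R Sigma T).

Fixpoint satd (b : bexp T) : set (state i) :=
  match b with
  | BZero => set0
  | BOne => setT
  | BTest t => sat i t
  | BAnd b c => satd b `&` satd c
  | BOr b c => satd b `|` satd c
  | BNot b => ~` satd b
  end.

Fixpoint psem (e : exp Sigma T) : kernel R (state i) :=
  match e with
  | Act p => eval i p
  | Bool b => ktest (satd b)
  | Seq e f => kseq (psem e) (psem f)
  | Ite b e f => kite (satd b) (psem e) (psem f)
  | Loop b e => kloop (satd b) (psem e)
  end.

(* The loop clause, with the iterates taken in the syntax. *)
Lemma psem_loopE b e x y :
  psem (Loop b e) x y =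
  limn (fun n =>
    psem (Seq (epow (Ite b e (Bool BOne)) n) (Bool (BNot b))) x y).
Proof.
have h n : psem (epow (Ite b e (Bool BOne)) n) =
    kpow (kite (satd b) (psem e) (ktest setT)) n.
  by elim: n => //= n ->.
by rewrite /= /loop_fun; under eq_fun do rewrite /kunroll -h.
Qed.

End ProbabilisticModel.

Arguments satd {R Sigma T} i b.
Arguments psem {R Sigma T} i e _.

(* Main.v *)
Require Import Defs.
From mathcomp Require Import all_boot all_order all_algebra.
From mathcomp Require Import all_classical all_reals all_analysis.

(** Every guarded string denotes a kernel, obtained by composing its actions
and atomic tests.  GKAT languages are prefix-free, so a string splits in at
most one way in a fusion product; hence the kernel of [e] is the pointwise sum
of the kernels of the strings in [lang e], which yields soundness.  Conversely,
for a guarded string [w] there is a deterministic interpretation whose states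
are the positions in [w] and in which only [w] leads from the first position to
the last one, so that [psem e] decides whether [w] belongs to [lang e]. *)

Set Implicit Arguments.
Unset Strict Implicit.
Unset Printing Implicit Defensive.
Import Order.TTheory GRing.Theory Num.Theory.
Import numFieldNormedType.Exports.
Import Defs.
Local Open Scope classical_set_scope.
Local Open Scope ring_scope.

(** * Nonnegative sums over arbitrary index sets *)

Section SumsOverSets.
Context {R : realType}.
Local Open Scope ereal_scope.

Lemma esumZl (I : choiceType) (A : set I) (r : R) (f : I -> \bar R) :
  (0 <= r)%R -> (forall i, 0 <= f i) ->
  \esum_(i in A) (r%:E * f i) = r%:E * \esum_(i in A) f i.
Proof.
move=> r0 f0; rewrite /esum -ereal_supZl//; last first.
  by apply/set0P; exists (\sum_(x \in set0) f x), set0 => //; exact: fsets_set0.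
rewrite image_comp; congr ereal_sup; apply: eq_imagel => B _ /=.
by rewrite ge0_mule_fsumr.
Qed.

(** Tonelli's theorem: both sides are one sum over pairs, up to the swap of coordinates. *)
Lemma exchange_esum (I J : choiceType) (A : set I) (B : set J)
    (f : I -> J -> \bar R) : (forall i j, 0 <= f i j) ->
  \esum_(i in A) \esum_(j in B) f i j = \esum_(j in B) \esum_(i in A) f i j.
Proof.
move=> f0; rewrite !esum_esum//.
rewrite (reindex_esum (B `*`` fun=> A) _ (fun p => (p.2, p.1)))//.
split=> [[j i] [] //|[j i] [j' i'] _ _ [-> ->] //|[i j] [Ai Bj]].
by exists (j, i).
Qed.

Lemma esum_single (I : choiceType) (A : set I) (x : I) (f : I -> \bar R) :
  0 <= f x -> (forall i, A i -> i != x -> f i = 0) ->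
  \esum_(i in A) f i = if x \in A then f x else 0.
Proof.
move=> fx0 f0; rewrite esum_mkcond (esumID [set x]); last first.
  move=> i _; have [->|ix] := eqVneq i x; first by case: ifP.
  by case: ifPn => //; rewrite inE => /f0->.
rewrite !setTI esum_set1 ?esum1 ?adde0//; last by case: ifP.
by move=> i /= /eqP ix; case: ifPn => //; rewrite inE => /f0->.
Qed.

Lemma finite_sub_bigcup (I : choiceType) (L : nat -> set I) (F : set I) :
  nondecreasing_seq L -> finite_set F -> F `<=` \bigcup_n L n ->
  exists n, F `<=` L n.
Proof.
move=> ndL /finite_seqP[s ->]; elim: s => [|x s IH] sL; first by exists 0%N.
have [|n sn] := IH; first by move=> y ys; apply: sL; rewrite /= inE ys orbT.
have [m _ Lmx] := sL x (mem_head _ _).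
have le_n : L n `<=` L (maxn m n) by apply/subsetPset/ndL/leq_maxr.
have le_m : L m `<=` L (maxn m n) by apply/subsetPset/ndL/leq_maxl.
exists (maxn m n) => y /=; rewrite inE => /predU1P[->|/sn/le_n//].
exact: le_m.
Qed.

(** Monotone convergence in the index set: a finite subset of the union already lies in one [L n].
    The loop case of [sums_to_lang] passes to the limit this way. *)
Lemma cvg_esum_bigcup (I : choiceType) (L : nat -> set I) (f : I -> \bar R) :
  nondecreasing_seq L -> (forall i, 0 <= f i) ->
  (\esum_(i in L n) f i) @[n --> \oo] --> \esum_(i in \bigcup_n L n) f i.
Proof.
move=> ndL f0.
have le_sum A B : A `<=` B -> \esum_(i in A) f i <= \esum_(i in B) f i.
  move=> AB; apply: le_ereal_sup => _ [X [finX XA] <-].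
  by exists X => //; split=> // x /XA/AB.
have -> : \esum_(i in \bigcup_n L n) f i =
    ereal_sup (range (fun n => \esum_(i in L n) f i)).
  apply/eqP; rewrite eq_le; apply/andP; split.
    apply: ge_ereal_sup => _ [F [finF FL] <-].
    have [n Fn] := finite_sub_bigcup ndL finF FL.
    apply: (@le_trans _ _ (\esum_(i in L n) f i)).
      by apply: ereal_sup_ubound; exists F.
    by apply: ereal_sup_ubound; exists n.
  by apply: ge_ereal_sup => _ [n _ <-]; apply: le_sum; exact: bigcup_sup.
apply: ereal_nondecreasing_cvgn => m n mn; apply: le_sum.
by apply/subsetPset/ndL.
Qed.

End SumsOverSets.

(** * Composition of kernels *)

Section KernelComposition.
Context {R : realType} {X : countType}.
Implicit Types (k l m : kernel R X) (B : set X).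

Lemma kseqE k l x z :
  (kseq k l x z)%:E = (\esum_(y in [set: X]) ((k x y)%:E * (l y z)%:E))%E.
Proof. exact: seq_funE. Qed.

(** By Tonelli both sides are the same double sum over the two intermediate states. *)
Lemma kseqA k l m : kseq k (kseq l m) = kseq (kseq k l) m.
Proof.
apply: eq_kernel => x z; apply: EFin_inj; rewrite 2!kseqE.
transitivity (\esum_(y in [set: X]) \esum_(y' in [set: X])
    ((k x y)%:E * ((l y y')%:E * (m y' z)%:E)))%E.
  apply: eq_esum => y _; rewrite kseqE esumZl ?subdist_ge0// => y'.
  by rewrite lee_fin mulr_ge0 ?subdist_ge0.
rewrite exchange_esum => [|y y']; last first.
  by rewrite lee_fin !mulr_ge0 ?subdist_ge0.
apply: eq_esum => y' _; rewrite kseqE muleC -esumZl ?subdist_ge0//.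
  by apply: eq_esum => y _; rewrite muleA muleC.
by move=> y; rewrite lee_fin mulr_ge0 ?subdist_ge0.
Qed.

Lemma ktest_seqE B k x z : kseq (ktest B) k x z = (x \in B)%:R * k x z.
Proof.
apply: EFin_inj; rewrite kseqE (@esum_single _ _ _ x).
- by rewrite in_setT /= /test_fun eqxx mulr1.
- by rewrite lee_fin mulr_ge0 ?subdist_ge0.
by move=> y _; rewrite eq_sym /= /test_fun => /negbTE->; rewrite mulr0 mul0e.
Qed.

End KernelComposition.

(** * Fusion, loop unrolling and prefix-freeness of languages *)

Section PrefixFreeLanguages.
Context {Sigma : Type} {T : finType}.
Local Notation gstring := (@gstring Sigma T).
Implicit Types (L K M : set gstring) (B : set (atom T)) (e : exp Sigma T).

Lemma bsemE (b : bexp T) : bsem b = [set a | beval a b].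
Proof. by apply/seteqP; split=> a /atom_leE. Qed.

Lemma bsem_not (b : bexp T) : bsem (BNot b) = ~` bsem b.
Proof. by rewrite !bsemE; apply/seteqP; split=> a /= /negP. Qed.

Lemma lang_atomsE B : lang_atoms B = [set z : gstring | B z.1 /\ z.2 = [::]].
Proof.
apply/seteqP; split=> [_ [a Ba <-] //|[a s] /= [Ba ->]].
by exists a.
Qed.

(** Splitting the list component avoids the partial operation [fuse]: the junction atom is read off
    the left part. *)
Lemma lang_fuseE L K : lang_fuse L K = [set z | exists s t,
  [/\ z.2 = s ++ t, L (z.1, s) & K (gs_last (z.1, s), t)]].
Proof.
apply/seteqP; split=> [z [[a s] [[b t] [Ls Kt]]]|[a _] /= [s [t [-> Ls Kt]]]].
  by rewrite /fuse /=; case: eqP => //= ab [<-]; exists s, t; rewrite ab.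
by exists (a, s), (gs_last (a, s), t); rewrite /fuse eqxx.
Qed.

Lemma lang_fuseA L K M :
  lang_fuse L (lang_fuse K M) = lang_fuse (lang_fuse L K) M.
Proof.
rewrite !lang_fuseE; apply/seteqP; split=> [[a z] /= [s [t [-> Ls]]]|].
  case=> s' [t' [-> Ks' Mt']]; exists (s ++ s'), t'; split.
  - by rewrite catA.
  - by exists s, s'.
  - by move: Mt'; rewrite /gs_last /= map_cat last_cat.
move=> [a z] /= [_ [t [-> [s [s' [-> Ls Ks']]] Mt]]].
exists s, (s' ++ t); split=> //; first by rewrite catA.
by exists s', t; split=> //; move: Mt; rewrite /gs_last /= map_cat last_cat.
Qed.

Lemma lang_fuseS L L' K K' :
  L `<=` L' -> K `<=` K' -> lang_fuse L K `<=` lang_fuse L' K'.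
Proof. by move=> LL KK z [x [y [/LL Lx /KK Ky xy]]]; exists x, y. Qed.

Lemma fuse_atoms B L : lang_fuse (lang_atoms B) L = [set z | B z.1 /\ L z].
Proof.
rewrite lang_fuseE lang_atomsE; apply/seteqP.
split=> [[a z] /=|[a z] /= [Ba Lz]].
  by move=> [s [t [-> [Ba ->] Lt]]].
by exists [::], z.
Qed.

Lemma fuse_atomsT L : lang_fuse (lang_atoms setT) L = L.
Proof. by rewrite fuse_atoms; apply/seteqP; split=> z; [case|]. Qed.

Lemma lang_fuse_atomsT L : lang_fuse L (lang_atoms setT) = L.
Proof.
rewrite lang_fuseE lang_atomsE; apply/seteqP; split=> [[a z] /=|[a z] Lz].
  by move=> [s [t [-> Ls [_ /= ->]]]]; rewrite cats0.
by exists z, [::]; rewrite cats0.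
Qed.

Lemma lang_iteE B L K : lang_ite B L K =
  [set z | B z.1 /\ L z] `|` [set z | ~ B z.1 /\ K z].
Proof. by rewrite /lang_ite !fuse_atoms. Qed.

Lemma lang_powS L n : lang_pow L n.+1 = lang_fuse L (lang_pow L n).
Proof.
elim: n => [|n IH]; first by rewrite /= fuse_atomsT lang_fuse_atomsT.
by rewrite -[LHS]/(lang_fuse (lang_pow L n.+1) L) {1}IH -lang_fuseA.
Qed.

Lemma lang_pow_sub L L' n : L `<=` L' -> lang_pow L n `<=` lang_pow L' n.
Proof. by move=> LL; elim: n => //= n IH; exact: lang_fuseS. Qed.

Definition unrolled (b : bexp T) e n : exp Sigma T :=
  Seq (epow (Ite b e (Bool BOne)) n) (Bool (BNot b)).

Lemma lang_unrolledE b e n : lang (unrolled b e n) =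
  lang_fuse (lang_pow (lang_ite (bsem b) (lang e) (lang_atoms setT)) n)
            (lang_atoms (~` bsem b)).
Proof.
have one : bsem (@BOne T) = setT by rewrite bsemE; apply/seteqP; split.
rewrite /= bsem_not; congr lang_fuse.
by elim: n => [|n IH] /=; rewrite ?one// IH.
Qed.

(** The additional round can be idle: at an atom where the guard fails, the conditional contains the
    one-atom string. *)
Lemma lang_unrolled_nondecreasing b e :
  nondecreasing_seq (fun n => lang (unrolled b e n)).
Proof.
apply/nondecreasing_seqP => n; apply/subsetPset; rewrite !lang_unrolledE /=.
rewrite -lang_fuseA; apply: lang_fuseS => // z zB.
have -> : z = (z.1, [::]).
  by case: z zB => a s; rewrite lang_atomsE => -[_ /= ->].
move: zB; rewrite lang_atomsE => -[/= nB _]; rewrite lang_fuseE /=.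
exists [::], [::]; split=> //.
by rewrite lang_iteE lang_atomsE; right.
Qed.

(** [lang_loop] counts rounds exactly, while [unrolled] also admits idle ones. Idle rounds can be
    erased, since the loop language absorbs a conditional round on its left. *)
Lemma lang_loopE b e :
  lang (Loop b e) = \bigcup_n lang (unrolled b e n).
Proof.
set B := bsem b; pose G := lang_ite B (lang e) (lang_atoms setT).
pose BL := lang_fuse (lang_atoms B) (lang e).
have BLG : BL `<=` G by move=> z; left.
apply/seteqP; split=> [z [n _ zn]|z [n _]].
  exists n => //; rewrite lang_unrolledE; apply: lang_fuseS zn => //.
  exact: lang_pow_sub.
rewrite lang_unrolledE -/B -/G.
have step : lang_fuse G (lang (Loop b e)) `<=` lang (Loop b e).
  move=> y [x [y' [[BLx|nBx] [m _ y'm] xy]]].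
    (* A genuine round raises the count by one. It is prepended, whereas [lang_pow] appends, hence
       [lang_powS]. *)
    by exists m.+1 => //; rewrite lang_powS -lang_fuseA; exists x, y'.
  have : lang_fuse (lang_atoms setT) (lang (Loop b e)) y.
    exists x, y'; split=> //; last by exists m.
    by move: nBx; rewrite lang_fuse_atomsT; apply: image_subset.
  by rewrite fuse_atomsT.
have nB : lang_atoms (~` B) `<=` lang (Loop b e).
  by move=> y yB; exists 0%N => //; rewrite fuse_atomsT.
(* The exit test is enlarged to the whole loop language, so that induction on [n] can absorb the
   factors [G] one by one. *)
move=> /(lang_fuseS (fun=> id) nB).
elim: n => [|n IH]; first by rewrite fuse_atomsT.
by rewrite /= -lang_fuseA => zn; apply/IH/(lang_fuseS (fun=> id) step).
Qed.

Definition prefix_free L : Prop :=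
  forall a s t, L (a, s) -> L (a, s ++ t) -> t = [::].

(** Of two prefixes of one list the shorter is a prefix of the longer, and prefix-freeness makes the
    remainder empty. *)
Lemma prefix_free_uniq L a s s' t t' : prefix_free L ->
  L (a, s) -> L (a, s') -> s ++ t = s' ++ t' -> s = s'.
Proof.
move=> pfL; wlog le_s : s s' t t' / (size s <= size s')%N.
  move=> h Ls Ls' e; have [le|/ltnW le] := leqP (size s) (size s').
    exact: h e.
  exact/esym/(h _ _ _ _ le Ls' Ls (esym e)).
move=> Ls Ls' /(congr1 (take (size s'))); rewrite [RHS]take_size_cat//.
rewrite take_cat ltnNge le_s /= => s'E.
by move: Ls'; rewrite -s'E => /(pfL _ _ _ Ls) ->; rewrite cats0.
Qed.

Lemma prefix_free_fuse L K :
  prefix_free L -> prefix_free K -> prefix_free (lang_fuse L K).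
Proof.
move=> pfL pfK a z r; rewrite lang_fuseE => -[s [t [/= -> Ls Kt]]].
move=> [s' [t' [/= e Ls' Kt']]]; rewrite -catA in e.
have ss' := prefix_free_uniq pfL Ls Ls' e; subst s'.
have /esym t'E := congr1 (drop (size s)) e.
rewrite !drop_size_cat// in t'E; subst t'.
exact: pfK Kt Kt'.
Qed.

Lemma prefix_free_atoms B : prefix_free (lang_atoms B).
Proof. by move=> a s t; rewrite lang_atomsE => -[_ /= ->] [_ /= ->]. Qed.

(** A string and its extension share their first atom, so both come from the same branch. *)
Lemma prefix_free_ite B L K :
  prefix_free L -> prefix_free K -> prefix_free (lang_ite B L K).
Proof.
move=> pfL pfK a s t; rewrite lang_iteE => -[] /= [Ba zs] [] [] //= _.
  exact: pfL.
exact: pfK.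
Qed.

Lemma prefix_free_lang e : prefix_free (lang e).
Proof.
elim: e => [p|b|e IHe f IHf|b e IHe f IHf|b e IHe].
- by move=> _ _ t [a [a' [-> ->]]] [? [? [_]]]; case: t.
- exact: prefix_free_atoms.
- exact: prefix_free_fuse.
- exact: prefix_free_ite.
(* A union of prefix-free languages need not be prefix-free, but the unrollings form a chain: a
   string and its extension lie together in one of them. *)
have pf n : prefix_free (lang (unrolled b e n)).
  apply: prefix_free_fuse; last exact: prefix_free_atoms.
  elim: n => [|n IHn] /=; first exact: prefix_free_atoms.
  apply: prefix_free_fuse => //; apply: prefix_free_ite => //.
  exact: prefix_free_atoms.
move=> a s t; rewrite lang_loopE => -[n _ Ls] [m _ Lst].
have ndL := @lang_unrolled_nondecreasing b e.
apply: (pf (maxn m n) a s).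
  by move: Ls; apply/subsetPset/ndL/leq_maxr.
by move: Lst; apply/subsetPset/ndL/leq_maxl.
Qed.

End PrefixFreeLanguages.

(** * The kernel of an expression as a sum over its guarded strings *)

Section StringSums.
Context {R : realType} {Sigma : choiceType} {T : finType}.
Variable i : interp R Sigma T.
Local Notation gstring := (@gstring Sigma T).

Definition state_atom (x : state i) : atom T := [ffun t => x \in sat i t].

Lemma mem_satd x (b : bexp T) : (x \in satd i b) = (state_atom x \in bsem b).
Proof.
rewrite bsemE; set v := state_atom x.
have -> : (v \in [set a : atom T | beval a b]) = beval v b by apply/asboolP/idP.
elim: b => [||t|b IHb c IHc|b IHb c IHc|b IHb] /=.
- by rewrite in_set0.
- by rewrite in_setT.
- by rewrite /v ffunE.
- by rewrite in_setI IHb IHc.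
- by rewrite in_setU IHb IHc.
- by rewrite in_setC IHb.
Qed.

(** Every atom is tested, both ends included, so strings that do not fuse compose to the zero
    kernel. *)
Fixpoint kpath (a : atom T) (s : seq (Sigma * atom T)) : kernel R (state i) :=
  let test := ktest [set x | state_atom x = a] in
  if s is (p, b) :: s' then kseq test (kseq (eval i p) (kpath b s')) else test.

Definition kstring (w : gstring) := kpath w.1 w.2.

Lemma kpath_start a s x y : state_atom x != a -> kpath a s x y = 0.
Proof.
move=> xa; have xNa : (x \in [set x | state_atom x = a]) = false.
  by apply: memNset; apply/eqP.
case: s => [|[p b] s] /=; first by rewrite /test_fun xNa mul0r.
by rewrite [LHS]ktest_seqE xNa mul0r.
Qed.

Lemma kpath_test a s :
  kseq (ktest [set x | state_atom x = a]) (kpath a s) = kpath a s.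
Proof.
apply: eq_kernel => x y; rewrite ktest_seqE.
have [xa|xa] := eqVneq (state_atom x) a; last by rewrite kpath_start ?mulr0.
by rewrite mem_set ?mul1r.
Qed.

(** The junction atom is tested on both sides; by [kpath_test] the repetition changes nothing. *)
Lemma kpath_cat a s t :
  kpath a (s ++ t) = kseq (kpath a s) (kpath (gs_last (a, s)) t).
Proof.
elim: s a => [|[p b] s IH] a /=; first by rewrite kpath_test.
by rewrite IH -!kseqA.
Qed.

Lemma kpath_end a s x y : state_atom y != gs_last (a, s) -> kpath a s x y = 0.
Proof.
move=> ya; rewrite -[s]cats0 kpath_cat [X in kseq _ X]/= kseq_testE.
rewrite memNset ?mulr0//.
exact/eqP.
Qed.

(** An intermediate state has only one atom, so it cannot pass both the last test of [u] and the
    first test of [v]. *)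
Lemma kseq_kstring_neq (u v : gstring) x y :
  gs_last u != v.1 -> kseq (kstring u) (kstring v) x y = 0.
Proof.
move=> uv; apply: EFin_inj; rewrite kseqE esum1// => z _; rewrite -EFinM.
have [zu|zu] := eqVneq (state_atom z) (gs_last u); last first.
  by rewrite /kstring kpath_end ?mul0r//; case: u zu {uv}.
by rewrite [kstring v _ _]kpath_start ?mulr0// zu.
Qed.

Definition string_sum (L : set gstring) x y : \bar R :=
  (\esum_(w in L) (kstring w x y)%:E)%E.

Lemma kstring_ge0 w x y : (0 <= (kstring w x y)%:E)%E.
Proof. by rewrite lee_fin subdist_ge0. Qed.

Definition sums_to L (k : kernel R (state i)) : Prop :=
  forall x y, string_sum L x y = (k x y)%:E.

(** Prefix-freeness of [L] ensures that each fused string is counted once. The sum over pairs then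
    factors at the intermediate state by Tonelli. *)
Lemma sums_to_fuse (L K : set gstring) k l : prefix_free L ->
  sums_to L k -> sums_to K l -> sums_to (lang_fuse L K) (kseq k l).
Proof.
move=> pfL Lk Kl x z; rewrite kseqE.
(* [D] holds the pairs that fuse; [g] fuses them and is injective on [D] by [prefix_free_uniq]. *)
pose g (p : gstring * gstring) : gstring := (p.1.1, p.1.2 ++ p.2.2).
pose D := (L `*`` fun=> K) `&` [set p | gs_last p.1 = p.2.1].
have -> : lang_fuse L K = g @` D.
  rewrite lang_fuseE; apply/seteqP; split=> [[a w] /= [s [t [-> Ls Kt]]]|].
    by exists ((a, s), (gs_last (a, s), t)).
  by move=> _ [[[a s] [b t]] [[/= Ls Kt] /= ab] <-]; exists s, t; rewrite ab.
rewrite /string_sum esum_image; last first.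
  move=> [[a s] [b t]] [[a' s'] [b' t']] /set_mem[[/= Ls _] /= <-].
  move=> /set_mem[[/= Ls' _] /= <-] [/= aa' e]; subst a'.
  have ss' := prefix_free_uniq pfL Ls Ls' e; subst s'.
  by have := congr1 (drop (size s)) e; rewrite !drop_size_cat// => ->.
(* Pairs outside [D] contribute 0, so the sum may run over all pairs. *)
transitivity (\esum_(u in L) \esum_(v in K)
    (kseq (kstring u) (kstring v) x z)%:E)%E.
  rewrite esum_esum => [|u v _ _]; last by rewrite lee_fin subdist_ge0.
  transitivity (\esum_(p in D) (kseq (kstring p.1) (kstring p.2) x z)%:E)%E.
    apply: eq_esum => -[[a s] [b t]] [_ /= ab].
    by rewrite /kstring /= kpath_cat ab.
  rewrite esum_mkcondr; apply: eq_esum => -[u v] _.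
  case: ifPn => //; rewrite notin_setE => uv.
  by rewrite kseq_kstring_neq//; apply/eqP.
transitivity (\esum_(u in L) \esum_(y in [set: state i]) \esum_(v in K)
    ((kstring u x y)%:E * (kstring v y z)%:E))%E.
  apply: eq_esum => u _; rewrite exchange_esum => [|y v]; last first.
    by rewrite mule_ge0 ?kstring_ge0.
  by apply: eq_esum => v _; exact: kseqE.
rewrite exchange_esum => [|u y]; last first.
  by apply: esum_ge0 => v _; rewrite mule_ge0 ?kstring_ge0.
apply: eq_esum => y _.
transitivity (\esum_(u in L)
    ((kstring u x y)%:E * \esum_(v in K) (kstring v y z)%:E))%E.
  apply: eq_esum => u _; rewrite esumZl ?subdist_ge0// => v.
  exact: kstring_ge0.
under eq_esum => u _ do rewrite -/(string_sum K y z) Kl muleC.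
rewrite esumZl ?subdist_ge0//; last by move=> u; exact: kstring_ge0.
by rewrite -/(string_sum L x y) Lk muleC.
Qed.

(** Only strings that start with the atom of [x] contribute, and for these the guard picks the same
    branch as the state does. *)
Lemma sums_to_ite (b : bexp T) (L K : set gstring) k l :
  sums_to L k -> sums_to K l ->
  sums_to (lang_ite (bsem b) L K) (kite (satd i b) k l).
Proof.
move=> Lk Kl x y; rewrite [subdist_fun _ _]ite_funE mem_satd.
transitivity (if state_atom x \in bsem b then string_sum L x y
              else string_sum K x y); last by case: ifP; rewrite ?Lk ?Kl.
rewrite lang_iteE /string_sum; case: ifPn => xB;
  rewrite esum_mkcond [RHS]esum_mkcond;
  apply: eq_esum => w _; have [xw|xw] := eqVneq (state_atom x) w.1;
  do ?[by rewrite /kstring kpath_start// !if_same];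
  move: xB; rewrite xw ?notin_setE ?inE => xB; congr (if _ then _ else _);
  apply/asboolP/asboolP; rewrite /=; tauto.
Qed.

Lemma sums_to_bool (b : bexp T) : sums_to (lang (Bool b)) (psem i (Bool b)).
Proof.
move=> x y; rewrite /string_sum (@esum_single _ _ _ (state_atom x, [::])).
- have -> : kstring (state_atom x, [::]) x y = (x == y)%:R.
    by rewrite /kstring /= /test_fun mem_set// mul1r.
  have -> : ((state_atom x, [::]) \in @lang Sigma T (Bool b)) =
      (x \in satd i b).
    by rewrite mem_satd /= lang_atomsE; apply/asboolP/asboolP => [[]|].
  by rewrite /= /test_fun; case: ifP; rewrite ?mul1r ?mul0r.
- exact: kstring_ge0.
move=> [a s]; rewrite /= lang_atomsE => -[_ /= ->] ne.
by rewrite /kstring kpath_start//; apply: contraNneq ne => ->.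
Qed.

Lemma sums_to_act (p : Sigma) : sums_to (lang (Act p)) (psem i (Act p)).
Proof.
move=> x y; pose w := (state_atom x, [:: (p, state_atom y)]).
have kpE a b : kpath a [:: (p, b)] x y =
    (x \in [set z | state_atom z = a])%:R *
    (eval i p x y * (y \in [set z | state_atom z = b])%:R).
  by rewrite /= [LHS]ktest_seqE kseq_testE.
rewrite /string_sum (@esum_single _ _ _ w).
- have -> : w \in lang (Act p).
    by apply/mem_set; exists (state_atom x), (state_atom y).
  by rewrite /kstring kpE !mem_set// mul1r mulr1.
- exact: kstring_ge0.
move=> _ [a [b ->]] ne; rewrite /kstring kpE.
have [xa|xa] := eqVneq (state_atom x) a; last first.
  by rewrite memNset ?mul0r//; exact/eqP.
have [yb|yb] := eqVneq (state_atom y) b; last first.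
  by rewrite [y \in _]memNset ?mulr0//; exact/eqP.
by move: ne; rewrite -xa -yb eqxx.
Qed.

Lemma sums_to_lang (e : exp Sigma T) : sums_to (lang e) (psem i e).
Proof.
elim: e => [p|b|e IHe f IHf|b e IHe f IHf|b e IHe].
- exact: sums_to_act.
- exact: sums_to_bool.
- by apply: sums_to_fuse => //; exact: prefix_free_lang.
- exact: sums_to_ite.
(* The unrollings use only the cases already treated and the hypothesis on [e]; both sides of the
   loop are their limits. *)
have unr n : sums_to (lang (unrolled b e n)) (psem i (unrolled b e n)).
  apply: sums_to_fuse; [exact: prefix_free_lang| |exact: sums_to_bool].
  elim: n => [|n IHn] /=; first exact: sums_to_bool.
  apply: sums_to_fuse => //; first exact: prefix_free_lang.
  by apply: sums_to_ite => //; exact: sums_to_bool.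
have unrE n : psem i (unrolled b e n) = kunroll (satd i b) (psem i e) n.
  by congr kseq; elim: n => //= n ->.
move=> x y; rewrite lang_loopE.
rewrite /string_sum -(cvg_lim _ (cvg_esum_bigcup
  (@lang_unrolled_nondecreasing _ _ b e) (fun w => kstring_ge0 w x y)))//.
under eq_fun do rewrite -/(string_sum _ x y) unr unrE.
by rewrite EFin_lim//; exact: kunroll_cvg.
Qed.

End StringSums.

(** * The deterministic interpretation read off a sequence of actions and atoms *)

Section StringInterpretation.
Context {R : realType} {Sigma : choiceType} {T : finType}.
Variables (a0 : atom T) (D : nat -> Sigma * atom T).

Definition atom_at (n : nat) : atom T := if n is m.+1 then (D m).2 else a0.

Definition path_from (n len : nat) : seq (Sigma * atom T) :=
  [seq D j | j <- iota n len].

(* The state [n] is the position just before the action [(D n).1]. *)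
Definition string_interp : interp R Sigma T :=
  @Interp R Sigma T nat
    (fun p n => @ktest R nat [set _ | (D n).1 = p] n.+1)
    (fun t => [set n | atom_at n t]).

Lemma state_atom_string_interp (n : nat) :
  @state_atom R Sigma T string_interp n = atom_at n.
Proof. by apply/ffunP => t; rewrite ffunE; apply/asboolP/idP. Qed.

Lemma kpath_string_interp a s (n m : nat) :
  @kpath R Sigma T string_interp a s n m =
  ([&& a == atom_at n, s == path_from n (size s) & m == (n + size s)%N])%:R.
Proof.
have testE b (k : nat) :
    (k \in [set x | @state_atom R Sigma T string_interp x = b]) =
    (b == atom_at k).
  by rewrite -state_atom_string_interp eq_sym; apply/asboolP/eqP.
elim: s a n => [|[p b] s IH] a n /=.
  by rewrite /test_fun testE addn0 -natrM mulnb [n == m]eq_sym.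
rewrite [LHS]ktest_seqE testE.
have -> (l : kernel R nat) : kseq (eval string_interp p) l n m =
    ((D n).1 == p)%:R * l n.+1 m.
  (* The tested set is full or empty, so [p] moves [n] to [n.+1] with mass 1 if it is the action of
     [D n], and has mass 0 otherwise. *)
  rewrite -[LHS]/(kseq (ktest [set _ | (D n).1 = p]) l n.+1 m) ktest_seqE.
  by congr (_%:R * _); apply: congr1; apply/asboolP/eqP.
rewrite IH -!natrM !mulnb addSnnS; congr (nat_of_bool _)%:R.
rewrite /= eqseq_cons -pair_eqE /= /pair_eq /=.
by rewrite [(D n).1 == p]eq_sym; case: (p == _); case: (b == _); case: (s == _).
Qed.

(** Runs are forced, so at most one term of the sum over [lang e] is nonzero. *)
Lemma psem_string_interp (e : exp Sigma T) (n : nat) :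
  psem string_interp e 0%N n = ((a0, path_from 0 n) \in lang e)%:R.
Proof.
apply: EFin_inj; rewrite -sums_to_lang /string_sum.
rewrite (@esum_single _ _ _ (a0, path_from 0 n)).
- rewrite /kstring kpath_string_interp size_map size_iota !eqxx.
  by case: ifP.
- exact: kstring_ge0.
move=> [a s] _ ne; rewrite /kstring kpath_string_interp /=.
rewrite add0n; case: and3P => // -[/eqP aE /eqP sE /eqP nE].
by rewrite nE -sE aE eqxx in ne.
Qed.

End StringInterpretation.

(** * Completeness string by string, and the equivalence *)

Lemma mem_lang_eq (R : realType) (Sigma : choiceType) (T : finType)
    (e f : exp Sigma T) (w : @gstring Sigma T) : inhabited Sigma ->
  (forall i : interp R Sigma T, psem i e = psem i f) ->
  (w \in lang e) = (w \in lang f).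
Proof.
(* [D] continues [s] forever by a default pair, whose action comes from the nonemptiness of [Sigma];
   only its first [size s] entries enter [path_from] below. *)
case: w => a s [p0] ef; pose D := nth (p0, a) s.
have sE : path_from D 0 (size s) = s by rewrite -[RHS](mkseq_nth (p0, a)).
have := psem_string_interp (R := R) a D e (size s).
rewrite ef psem_string_interp sE => /eqP; rewrite eqr_nat => /eqP.
by case: (_ \in _); case: (_ \in _).
Qed.

Theorem theorem2p7 (R : realType) (Sigma : Type) (T : finType)
    (hSigma : inhabited Sigma) (hT : inhabited T) (e f : exp Sigma T) :
  lang e = lang f <->
  (forall i : interp R Sigma T, psem i e = psem i f).
Proof.
split=> [ef i|ef].
  apply: eq_kernel => x y; apply: EFin_inj.
  (* Sums over guarded strings require a choice structure on [Sigma]; [{classic Sigma}] supplies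
     one. *)
  have sumE := @sums_to_lang R {classic Sigma} T i.
  by rewrite -!sumE ef.
apply/seteqP; split=> w we; apply/set_mem.
  by rewrite -(@mem_lang_eq R {classic Sigma} T e f w hSigma ef) mem_set.
by rewrite (@mem_lang_eq R {classic Sigma} T e f w hSigma ef) mem_set.
Qed.
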